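(* Let $X$ be a compact Hausdorff space and let $G$ be a countable group of homeomorphisms of $X$. Assume that the following conditions are satisfied: (i) $G\curvearrowright X$ is an extreme boundary action; (ii) for every non-empty open $U\subset X$ and every finite index subgroup $\Gamma\le G_U$, there exists a non-empty open $V\subset U$ such that $G_V\le[\Gamma,\Gamma]$. Then $\mathcal{S}_G(X)\preccurlyeq\mathcal{H}$ for every non-trivial uniformly recurrent subgroup $\mathcal{H}$ of $G$. In particular, if there is $H\in\mathcal{S}_G(X)$ which is a maximal subgroup of $G$, then the only uniformly recurrent subgroups of $G$ are $1$, $\mathcal{S}_G(X)$ and $G$.
   Context: For $U\subset X$, the rigid stabilizer $G_U$ is the subgroup of $G$ of elements fixing $X\setminus U$ pointwise. A subset $Y\subset X$ is compressible if there exists $x\in X$ such that for every open $U\ni x$ there is $g\in G$ with $g(Y)\subset U$. The action is extremely proximal if every closed $C\neq X$ is compressible; minimal if every orbit is dense. An extreme boundary action is an action on a compact space that is minimal and extremely proximal. $\mathrm{Sub}(G)$ is the space of subgroups of $G$ with the topology induced from $\{0,1\}^G$, on which $G$ acts by conjugation. A uniformly recurrent subgroup (URS) is a (non-empty) closed minimal $G$-invariant subset of $\mathrm{Sub}(G)$. For $N$ normal in $G$, $\{N\}$ is denoted $N$; $1$ denotes the trivial URS $\{\{1\}\}$, and a URS is non-trivial if it differs from it. With $X_0$ the set of continuity points of $x\mapsto G_x\in\mathrm{Sub}(G)$, the stabilizer URS $\mathcal{S}_G(X)$ is the closure of $\{G_x : x\in X_0\}$ (a URS whenever the action is minimal). For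 $A,B\subset\mathrm{Sub}(G)$, $A\preccurlyeq B$ means that there exist $H\in A$ and $K\in B$ with $H\le K$. *)

(* Defs.v *)
From HB Require Import structures.
From mathcomp Require Import all_boot.
From mathcomp Require Import boolp classical_sets functions cardinality.
From mathcomp Require Import topology.

Set Implicit Arguments.
Unset Strict Implicit.
Unset Printing Implicit Defensive.

Import Algebra.

Local Open Scope classical_set_scope.
Local Open Scope group_scope.

Definition is_subgroup (G : groupType) (H : set G) : Prop :=
  group_closed [in H].

Lemma is_subgroupP (G : groupType) (H : set G) :
  is_subgroup H <-> H 1 /\ (forall x y, H x -> H y -> H (x / y)).
Proof.
split=> [[/set_mem H1 HB]|[H1 HB]].
  by split=> // x y /mem_set Hx /mem_set Hy; apply/set_mem/HB.
by split=> [|x y /set_mem Hx /set_mem Hy]; apply/mem_set => //; apply: HB.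
Qed.

Record subgroup (G : groupType) := Subgroup {
  sub_set :> set G;
  sub_setP : is_subgroup sub_set }.

HB.instance Definition _ (G : groupType) := gen_eqMixin (subgroup G).
HB.instance Definition _ (G : groupType) := gen_choiceMixin (subgroup G).

Definition sub_indic (G : groupType) (H : subgroup G) : {ptws G -> bool} :=
  fun g => g \in (H : set G).

HB.instance Definition _ (G : groupType) :=
  Topological.copy (subgroup G) (initial_topology (@sub_indic G)).

Fact trivial_subgroup_subproof (G : groupType) : is_subgroup [set (1 : G)].
Proof. by apply/is_subgroupP; split=> // x y -> ->; rewrite /= divg1. Qed.

Definition trivial_subgroup (G : groupType) : subgroup G :=
  Subgroup (@trivial_subgroup_subproof G).

Fact full_subgroup_subproof (G : groupType) : is_subgroup [set: G].
Proof. exact/is_subgroupP. Qed.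

Definition full_subgroup (G : groupType) : subgroup G :=
  Subgroup (@full_subgroup_subproof G).

Fact conj_sub_subproof (G : groupType) (g : G) (H : subgroup G) :
  is_subgroup [set g * h * g^-1 | h in H].
Proof.
have /is_subgroupP[H1 HB] := sub_setP H.
apply/is_subgroupP; split; first by exists 1 => //; rewrite mulg1 mulgV.
move=> _ _ [h Hh <-] [k Hk <-]; exists (h / k); first exact: HB.
by rewrite !invgM invgK !mulgA mulgVK.
Qed.

Definition conj_sub (G : groupType) (g : G) (H : subgroup G) : subgroup G :=
  Subgroup (conj_sub_subproof g H).

(* Meant for subgroups K of L: the index of K in L is finite. *)
Definition finite_index (G : groupType) (K L : set G) : Prop :=
  finite_set [set [set g * k | k in K] | g in L].

Definition derived (G : groupType) (K : set G) : set G :=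
  smallest (@is_subgroup G) [set [~ a, b] | a in K & b in K].

Definition maximal_subgroup (G : groupType) (H : subgroup G) : Prop :=
  H <> full_subgroup G /\
  forall K : subgroup G, H `<=` K -> K = H \/ K = full_subgroup G.

Definition act_orbit (G T : Type) (a : G -> T -> T) (x : T) : set T :=
  [set a g x | g in [set: G]].

Definition minimal_on (G : Type) (T : topologicalType) (a : G -> T -> T)
  (A : set T) : Prop := forall x, A x -> A `<=` closure (act_orbit a x).

(* A group of homeomorphisms of X is presented as an abstract group with a
   faithful action by continuous maps; each homeo_act g is then a homeomorphism,
   with inverse homeo_act g^-1, and G is identified with a subgroup of Homeo(X). *)
Record homeo_group (G : groupType) (X : topologicalType) := HomeoGroup {
  homeo_act :> G -> X -> X;
  homeo_act1 : forall x, homeo_act 1 x = x;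
  homeo_actM : forall g h x, homeo_act (g * h) x = homeo_act g (homeo_act h x);
  homeo_act_continuous : forall g, continuous (homeo_act g);
  homeo_act_faithful : forall g, (forall x, homeo_act g x = x) -> g = 1 }.

Section Actions.
Variables (G : groupType) (X : topologicalType) (a : homeo_group G X).

Definition rigid_stabilizer (U : set X) : set G :=
  [set g | forall x, ~ U x -> a g x = x].

Definition compressible (Y : set X) : Prop :=
  exists x : X, forall U : set X, open U -> U x ->
    exists g : G, [set a g y | y in Y] `<=` U.

Definition extremely_proximal : Prop :=
  forall C : set X, closed C -> C <> [set: X] -> compressible C.

Definition extreme_boundary_action : Prop :=
  [/\ compact [set: X], minimal_on a [set: X] & extremely_proximal].

Fact stabilizer_subproof (x : X) : is_subgroup [set g | a g x = x].
Proof.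
apply/is_subgroupP; split; first exact: homeo_act1.
by move=> g h /= gx hx; rewrite homeo_actM -[in LHS]hx -(homeo_actM _ h^-1) mulVg homeo_act1.
Qed.

Definition stabilizer (x : X) : subgroup G := Subgroup (stabilizer_subproof x).

Definition stabilizer_continuity_points : set X :=
  [set x | {for x, continuous stabilizer}].

Definition stabilizer_URS : set (subgroup G) :=
  closure [set stabilizer x | x in stabilizer_continuity_points].

End Actions.

Definition is_URS (G : groupType) (A : set (subgroup G)) : Prop :=
  [/\ A !=set0, closed A, forall g H, A H -> A (conj_sub g H)
    & minimal_on (@conj_sub G) A].

Definition sub_preceq (G : groupType) (A B : set (subgroup G)) : Prop :=
  exists H K : subgroup G, [/\ A H, B K & H `<=` K].

(* Main.v *)
Require Import Defs.
From mathcomp Require Import all_boot.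
From mathcomp Require Import boolp classical_sets functions cardinality.
From mathcomp Require Import topology.

(** The argument has three steps.

    A non-trivial uniformly recurrent subgroup is closed and misses the trivial
    subgroup, so a basic neighbourhood of the trivial subgroup misses it too:
    there is a finite set P of non-trivial elements that meets every member,
    hence every conjugate of a given member H ([URS_confined]).

    The core is [confined_contains_local_derived]: if every conjugate of H meets
    P and all rigid stabilizers of non-empty open sets are non-trivial, then H
    contains the derived subgroup of a finite index subgroup of some rigid
    stabilizer. To each p_i in P attach an open set U_i displaced by p_i, with
    the U_i pairwise disjoint and p_i U_i disjoint from all U_j
    ([disjoint_opens]). Every k in the product of the groups G_(U_i) has a
    colour i with k^-1 p_i k in H. If k and l have colour i and differ only in
    their coordinates x, y in G_(U_i), then the product of k^-1 p_i k with the
    inverse of l^-1 p_i l is x^-1 y . p_i (x y^-1) p_i^-1, and this element of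
    H does not involve the other coordinates; x and y are then called [linked].
    As there are finitely many colours, counting ([exists_large_fibre]) gives an
    i for which every large finite grid in G_(U_i) has a large subset of
    pairwise linked elements. Let D be the group of elements of G_(U_i) that
    become elements of H after multiplication by an element of G_(p_i U_i).
    Linked elements lie in the same left coset of D, so D has finite index
    ([infinite_index_cliques]). If H met G_(U_i) trivially, a grid x_r y_c whose
    x_r move the support of all y_c to disjoint places would have no linked
    rectangle, and a subset of a grid without rectangles is small
    ([card_rectangle_free], [trivial_inter_cliques]). So H contains some m <> 1
    of G_(U_i); the subgroup D normalizes the intersection of H with G_(U_i),
    and the double commutator trick [[m, x], y] = [x, y], for x, y in D
    supported in an open set displaced by m, puts the derived subgroup of a
    finite index subgroup of a smaller rigid stabilizer into H
    ([nontrivial_inter_contains_local_derived]).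

    By the hypothesis on finite index subgroups of rigid stabilizers, H then
    contains G_V for some non-empty open V, which is trivially true if some rigid
    stabilizer of a non-empty open set is trivial.
    Extreme proximality and minimality move any proper closed subset of X into
    V, so conjugates of H contain G_C for every proper closed C. For a
    continuity point x, all elements of the stabilizer of x fix a neighbourhood
    of x, so finitely many of them lie in one such G_C; compactness of the space
    of subgroups gives a member of the URS above the stabilizer of x
    ([dominate_stabilizer], [limit_above]). Continuity points exist by a Baire
    argument, as the group is countable ([exists_continuity_point]).

    For the classification, two uniformly recurrent subgroups with a common
    member coincide ([URS_eq]). If a member M of the stabilizer URS is maximal,
    the first part and minimality of the stabilizer URS produce, by the same
    limit lemma, a member of any non-trivial URS containing M; it is M or G. *)

Set Implicit Arguments.
Unset Strict Implicit.
Unset Printing Implicit Defensive.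

Import Algebra.

(** * Two counting arguments *)

Section Counting.

Definition update n (T : finType) (f : {ffun 'I_n -> T}) i t :
  {ffun 'I_n -> T} :=
  [ffun j => if j == i then t else f j].

(** If all fibres of colour i in direction i had at most m points, double
    counting along each direction would bound each colour class by m * #|T| ^
    n.-1, too little for n classes to fill the cube. *)
Lemma exists_large_fibre n (T : finType) m (c : {ffun 'I_n -> T} -> 'I_n) :
  n * m < #|T| ->
  exists i f, m < #|[set t | c (update f i t) == i]|.
Proof.
move=> nmT.
have [/existsP[i /existsP[f]]|/existsPn none] := boolP
  [exists i, exists f, m < #|[set t | c (update f i t) == i]|].
  by exists i, f.
have {none}small i f : #|[set t | c (update f i t) == i]| <= m.
  by have /existsPn/(_ f) := none i; rewrite -leqNgt.
have T_gt0 : 0 < #|T| by apply: leq_trans nmT.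
exfalso; move: nmT; apply/negP; rewrite -leqNgt.
have F_gt0 : 0 < #|{ffun 'I_n -> T}| by rewrite card_ffun expn_gt0 T_gt0.
have fibre i : #|T| * #|[set f | c f == i]| <= #|{ffun 'I_n -> T}| * m.
  rewrite -[_ * m]sum_nat_const.
  apply: (@leq_trans (\sum_(f : {ffun 'I_n -> T})
    #|[set t | c (update f i t) == i]|)); last exact: leq_sum.
  rewrite mulnC -sum1_card big_distrl /=.
  under eq_bigr do rewrite mul1n -sum1_card.
  under [leqRHS]eq_bigr do rewrite -sum1_card.
  rewrite !pair_big_dep /=.
  (* Recording a point of a line and the coordinate it replaces is an
     involution, so the points of colour i summed over all lines in direction
     i are counted #|T| times each. *)
  pose swap (p : {ffun 'I_n -> T} * T) := (update p.1 i p.2, p.1 i).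
  have swapK : involutive swap.
    move=> [f t]; rewrite /swap /=; congr pair; last by rewrite ffunE eqxx.
    by apply/ffunP=> j; rewrite !ffunE; case: eqP => // ->.
  rewrite [leqRHS](reindex_inj (inv_inj swapK)) /=.
  rewrite [leqRHS](eq_bigl (fun p => c p.1 == i)); last first.
    move=> p; rewrite !inE; congr (c _ == i).
    by have /(congr1 fst) := swapK p.
  by apply: eq_leq; apply: eq_bigl => p; rewrite !inE andbT.
rewrite -(leq_pmul2l F_gt0) [leqRHS]mulnCA.
rewrite mulnC -[X in _ * X <= _]cardsT -sum1_card (partition_big c xpredT) //=.
rewrite big_distrr /= -[n in n * _]card_ord -sum_nat_const.
apply: leq_sum => i _. apply: (leq_trans _ (fibre i)); apply: eq_leq.
by congr (_ * _); rewrite -sum1_card; apply: eq_bigl => f; rewrite !inE.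
Qed.

(** A column contributes its top point, counted by m, and for any other point
    the pair (top row, row); a pair of rows occurring in two columns would be a
    rectangle. *)
Lemma card_rectangle_free n m (C : {set 'I_n * 'I_m}) :
  (forall i i' j j', [/\ (i, j) \in C, (i', j) \in C, (i, j') \in C
     & (i', j') \in C] -> i = i' \/ j = j') ->
  #|C| <= m + n * n.
Proof.
move=> rect_free.
pose top j := [pick i | (i, j) \in C].
have topP i j : (i, j) \in C -> exists2 r, top j = Some r & (r, j) \in C.
  rewrite /top => Cij; case: pickP => [r Crj|/(_ i)]; last by rewrite Cij.
  by exists r.
pose code (p : 'I_n * 'I_m) : 'I_m + 'I_n * 'I_n :=
  if top p.2 is Some r then if p.1 == r then inl p.2 else inr (r, p.1)
  else inl p.2.
have code_inj : {in C &, injective code}.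
  move=> [i j] [i' j'] Cij Cij'; rewrite /code /=.
  have [r topr Crj] := topP _ _ Cij; have [r' tj' Crj'] := topP _ _ Cij'.
  rewrite topr tj'; case: eqP => [->|ir]; case: eqP => [->|ir'] //.
    by case=> jj'; move: topr; rewrite jj' tj' => -[->].
  case=> rr' ii'; rewrite -{}rr' -{}ii' in Crj' Cij' *.
  have [/esym //|-> //] := rect_free r i j j' (And4 Crj Cij Crj' Cij').
rewrite -(card_in_imset code_inj) (leq_trans (max_card _)) //.
by rewrite card_sum card_prod !card_ord.
Qed.

End Counting.

Local Open Scope classical_set_scope.
Local Open Scope group_scope.

(** * Subgroups, cosets and products *)

Section SubgroupBasics.
Variable G : groupType.
Implicit Types (H K L : subgroup G) (g h k : G).

Lemma subgroup1 H : sub_set H 1.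
Proof. by have /is_subgroupP[] := Defs.sub_setP H. Qed.

Lemma subgroupF H g h : sub_set H g -> sub_set H h -> sub_set H (g / h).
Proof. by have /is_subgroupP[_] := Defs.sub_setP H; apply. Qed.

Lemma subgroupV H g : sub_set H g -> sub_set H g^-1.
Proof.
by move=> Hg; rewrite -div1g; apply: subgroupF => //; apply: subgroup1.
Qed.

Lemma subgroupM H g h : sub_set H g -> sub_set H h -> sub_set H (g * h).
Proof. by move=> Hg Hh; rewrite -[h]invgK; apply/subgroupF/subgroupV. Qed.

Lemma subgroup_eq H K : (forall g, sub_set H g <-> sub_set K g) -> H = K.
Proof.
case: H K => [H subH] [K subK] /= eqHK.
have /seteqP eqHK' : H = K by apply/seteqP; split=> g /eqHK.
move: subH subK; rewrite (_ : H = K); last exact/seteqP.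
by move=> subH subK; rewrite (Prop_irrelevance subH subK).
Qed.

Lemma conj_subE g H h : sub_set (conj_sub g H) h = sub_set H (g^-1 * h * g).
Proof.
apply/propext; split=> [[k Hk <-]|Hh].
  by rewrite !mulgA mulVg mul1g mulgVK.
by exists (g^-1 * h * g) => //; rewrite !mulgA mulgV mul1g mulgK.
Qed.

Lemma derived_sub (K : set G) L :
  (forall g h, K g -> K h -> sub_set L [~ g, h]) ->
  derived K `<=` L.
Proof.
move=> KL; apply: smallest_sub; first exact: Defs.sub_setP.
by move=> _ [g Kg [h Kh <-]]; apply: KL.
Qed.


(** The changed factor commutes with the other ones, so it can be moved to
    either end of the product. *)
Lemma prod_update (I : eqType) (r : seq I) (g h : I -> G) i :
  uniq r -> i \in r -> (forall j, j != i -> g j = h j) ->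
  (forall j, j != i -> commute (g i) (g j)) ->
  (forall j, j != i -> commute (h i) (g j)) ->
  (\prod_(j <- r) g j / \prod_(j <- r) h j = g i / h i) /\
  ((\prod_(j <- r) g j)^-1 * \prod_(j <- r) h j = (g i)^-1 * h i).
Proof.
move=> + + gh cg ch; elim: r => // j r IHr /= /andP[jr ur].
rewrite inE !big_cons; case: (eqVneq i j) jr => [<- jr _|ij jr /= ir].
  have nir (k : I) : k \in r -> k != i by apply: contraTneq => ->.
  have -> : \prod_(k <- r) h k = \prod_(k <- r) g k.
    by apply: eq_big_seq => k /nir /gh.
  set R := \prod_(k <- r) g k.
  have cR z : (forall k : I, k != i -> commute z (g k)) -> commute z R.
    move=> cz; rewrite /R big_seq; apply: commute_prod => k /nir; exact: cz.
  have [gR hR] := (cR _ cg, cR _ ch).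
  split; first by rewrite invgM !mulgA mulgK.
  have gVR : (g i)^-1 * R = R * (g i)^-1.
    by apply/commute_sym/commuteV/commute_sym.
  by rewrite invgM -mulgA hR (mulgA _ R) gVR -!mulgA mulKg.
have ji : j != i by rewrite eq_sym.
have [IH1 IH2] := IHr ur ir; rewrite -(gh j ji); split.
  rewrite invgM !mulgA -(mulgA (g j)) IH1.
  have -> : g j * (g i / h i) = (g i / h i) * g j.
    apply: commuteM; first exact/commute_sym/cg.
    exact/commuteV/commute_sym/ch.
  by rewrite mulgK.
by rewrite invgM !mulgA mulgVK IH2.
Qed.

(** The relation that two elements k, l of a rigid stabilizer satisfy when
    g^-1 * p * g and h^-1 * p * h are in H for two elements g, h that differ
    exactly by having k, respectively l, as their coordinate in it. *)
Definition linked (p : G) H k l :=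
  sub_set H (k^-1 * l * (p * (k / l) * p^-1)).

(** The quotient of the two conjugates of p is g^-1 * (p * (g / h) * p^-1) * h,
    whose middle factor commutes with h. *)
Lemma linked_conj p H k l g h :
  sub_set H (g^-1 * p * g) -> sub_set H (h^-1 * p * h) ->
  g / h = k / l -> g^-1 * h = k^-1 * l -> commute (p * (k / l) * p^-1) h ->
  linked p H k l.
Proof.
rewrite /linked => Hg Hh <- <- com; rewrite -mulgA -com.
have := subgroupF Hg Hh; congr (sub_set H _).
by rewrite !invgM invgK !mulgA.
Qed.

Lemma infinite_index_reps (K L : set G) : ~ finite_index K L ->
  exists2 s : nat -> G, forall i, L (s i) &
    injective (fun i => [set s i * k | k in K]).
Proof.
move=> /infiniteP /pcard_leP /injfunPex[/= f fL finj].
have /choice[s sL] : forall i, exists g, L g /\ f i = [set g * k | k in K].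
  by move=> i; have [g Lg <-] := fL i I; exists g.
exists s => [i|i j]; first by have [] := sL i.
by have [_ <-] := sL i; have [_ <-] := sL j => /finj; apply; rewrite inE.
Qed.

Lemma coset_eq H g h : sub_set H (g^-1 * h) ->
  [set g * k | k in (H : set G)] = [set h * k | k in (H : set G)].
Proof.
move=> Hgh; apply/seteqP; split=> _ [k Hk <-].
  exists ((g^-1 * h)^-1 * k); first exact/subgroupM/Hk/subgroupV.
  by rewrite invgM invgK !mulgA mulgV mul1g.
exists (g^-1 * h * k); first exact: subgroupM.
by rewrite !mulgA mulgV mul1g.
Qed.

Lemma finite_index_inter (K L M : set G) : is_subgroup M ->
  finite_index K L -> M `<=` L -> finite_index (K `&` M) M.
Proof.
move=> /is_subgroupP[M1 MF] KL ML.
have MV g : M g -> M g^-1 by move=> Mg; rewrite -div1g; apply: MF.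
have MM g h : M g -> M h -> M (g * h).
  by move=> Mg Mh; rewrite -[h]invgK; apply/MF/MV.
apply: sub_finite_set (finite_image (fun A => A `&` M) KL).
move=> _ [g Mg <-]; exists [set g * k | k in K].
  by exists g => //; apply: ML.
apply/seteqP; split=> [_ [[k Kk <-] Mgk]|_ [k [Kk Mk] <-]]; last first.
  by split; [exists k|apply: MM].
exists k => //; split=> //; rewrite -[k](mulKg g).
by apply: MM => //; apply: MV.
Qed.

End SubgroupBasics.

(** * The space of subgroups *)

Section SubgroupSpace.
Variable G : groupType.
Implicit Types (H K L : subgroup G) (g h : G) (s : seq G).

(** The basic neighbourhoods of H. *)
Definition agree_on s H : set (subgroup G) :=
  [set L | forall g, g \in s -> sub_set L g <-> sub_set H g].

Lemma agree_filter H : Filter (filter_from setT (agree_on^~ H)).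
Proof.
apply: filter_from_filter; first by exists [::].
move=> s t _ _; exists (s ++ t) => // L LH.
by split=> g gst; apply: LH; rewrite mem_cat gst ?orbT.
Qed.

Lemma sub_indic_continuous : continuous (@sub_indic G).
Proof.
exact: (@initial_continuous (subgroup G) {ptws G -> bool} (@sub_indic G)).
Qed.

Lemma nbhs_mem H g : nbhs H [set L | sub_set L g <-> sub_set H g].
Proof.
have ev : nbhs (sub_indic H : {ptws G -> bool})
               [set f : {ptws G -> bool} | f g = sub_indic H g].
  have Dg : nbhs (sub_indic H g) [set sub_indic H g].
    by rewrite nbhs_principalE.
  exact: (@proj_continuous G (fun=> bool) g (sub_indic H) _ Dg).
have {ev} : nbhs H (@sub_indic G @^-1` [set f | f g = sub_indic H g]) :=
  sub_indic_continuous ev.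
apply: filterS => L /= /(congr1 is_true).
by rewrite /sub_indic !in_setE => ->.
Qed.

Lemma agree_nbhs H s : nbhs H (agree_on s H).
Proof.
elim: s => [|g s IHs]; first by apply: filterS filterT => L _ g.
apply: filterS (filterI (nbhs_mem H g) IHs) => L /= [Lg Ls] h.
by rewrite inE => /predU1P[->|/Ls].
Qed.

(** The basic neighbourhoods generate a filter that converges to H
    coordinatewise, hence for the product topology. *)
Lemma nbhs_subgroupE H : nbhs H = filter_from setT (agree_on^~ H).
Proof.
apply/seteqP; split=> A; last first.
  by case=> s _ sA; apply: filterS sA (agree_nbhs H s).
have FF := agree_filter H.
move=> [_ [[B oB <-] BH sBA]].
suff cvH : (@sub_indic G @ filter_from setT (agree_on^~ H)) -->
    (sub_indic H : {ptws G -> bool}).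
  exact: filterS sBA (cvH _ (open_nbhs_nbhs (conj oB BH))).
apply/cvg_sup => g; apply/cvg_image.
  by rewrite eqEsubset; split=> v // _; exists (cst v).
move=> C; rewrite /= nbhs_principalE => CHg.
exists ([set f | C (f g)]); last first.
  by rewrite eqEsubset; split=> [v [f Cf <-] //|v Cv]; exists (cst v).
change (filter_from setT (agree_on^~ H) [set L | C (sub_indic L g)]).
exists [:: g] => // L /(_ g); rewrite inE eqxx => /(_ isT) LHg /=.
suff -> : sub_indic L g = sub_indic H g by move/principal_filterP: CHg.
by apply/idP/idP; rewrite /sub_indic !in_setE => /LHg.
Qed.

Lemma nbhs_subgroupP H (A : set (subgroup G)) :
  nbhs H A <-> exists s, agree_on s H `<=` A.
Proof. by rewrite nbhs_subgroupE; split=> [[s _]|[s]]; exists s. Qed.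

Lemma closure_subgroupP (A : set (subgroup G)) H :
  closure A H <-> forall s, exists2 L, A L & agree_on s H L.
Proof.
split=> [clH s|clH B /nbhs_subgroupP[s sB]].
  by have [L [AL HL]] := clH _ (agree_nbhs H s); exists L.
by have [L AL /sB BL] := clH s; exists L.
Qed.

(** An ultrafilter converges to the set of elements that belong to almost all
    subgroups. *)
Lemma compact_subgroup : compact [set: subgroup G].
Proof.
rewrite compact_ultra => F FU _.
pose K := [set g | F [set L | sub_set L g]].
have subK : is_subgroup K.
  apply/is_subgroupP; split.
    by apply: filterS filterT => L _; apply: subgroup1.
  move=> g h Kg Kh; apply: filterS (filterI Kg Kh) => L [].
  exact: subgroupF.
exists (Subgroup subK); split=> // A /nbhs_subgroupP[s].
suff Fs : F (agree_on s (Subgroup subK)) by move=> sA; exact: filterS sA Fs.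
elim: s => [|g s IHs]; first by apply: filterS filterT => L _ g.
have Fg : F [set L | sub_set L g <-> K g].
  have [Fg|nFg] := in_ultra_setVsetC [set L : subgroup G | sub_set L g] FU.
    by apply: filterS (Fg) => L.
  have nKg : ~ K g.
    by move=> Kg; have [L [Lg]] := filter_ex (filterI Kg nFg); apply.
  by apply: filterS nFg => L /= nLg; split.
apply: filterS (filterI Fg IHs) => L /= [Lg Ls] h.
by rewrite inE => /predU1P[->|/Ls].
Qed.

(** The members of A containing a given finite part of M form a filter base,
    whose cluster points in the compact set A contain every element of M. *)
Lemma limit_above (A : set (subgroup G)) (M : set G) : closed A ->
  (forall s, (forall g, g \in s -> M g) ->
     exists2 K, A K & forall g, g \in s -> sub_set K g) ->
  exists2 K, A K & M `<=` K.
Proof.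
move=> clA AM.
pose D : set (seq G) := [set s | forall g, g \in s -> M g].
pose B s := [set K | A K /\ forall g, g \in s -> sub_set K g].
have FB : ProperFilter (filter_from D B).
  apply: filter_from_proper; last by move=> s /AM[K AK sK]; exists K.
  apply: filter_from_filter; first by exists [::].
  move=> s t Ds Dt; exists (s ++ t).
    by move=> g; rewrite mem_cat => /orP[/Ds|/Dt].
  by move=> K [AK sK]; split; split=> // g gs; apply: sK;
    rewrite mem_cat gs ?orbT.
have FA : filter_from D B A by exists [::] => // K [].
have [K [AK clK]] :=
  subclosed_compact clA compact_subgroup (@subsetT _ A) FB FA.
exists K => // g Mg.
have FBg : filter_from D B (B [:: g]).
  by exists [:: g] => // h; rewrite inE => /eqP->.
have [L [[_ Lg] /(_ g)]] := clK _ _ FBg (agree_nbhs K [:: g]).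
by rewrite inE eqxx => /(_ isT)[+ _]; apply; apply: Lg; rewrite inE.
Qed.

End SubgroupSpace.

(** * Uniformly recurrent subgroups *)

Section URS.
Variable G : groupType.
Implicit Types (H K : subgroup G) (A B : set (subgroup G)).

Lemma URS_eq A B K : is_URS A -> is_URS B -> A K -> B K -> A = B.
Proof.
have sub C D : is_URS C -> is_URS D -> C K -> D K -> C `<=` D.
  move=> [_ _ _ minC] [_ clD invD _] CK DK H /(minC _ CK).
  rewrite ((closure_id D).1 clD); apply: closureS => _ [g _ <-]; exact: invD.
by move=> uA uB AK BK; apply/seteqP; split; apply: sub.
Qed.

Lemma URS_set1 H : (forall g, conj_sub g H = H) -> is_URS [set H].
Proof.
move=> fixH; split=> [||g _ ->|_ -> _ ->]; first by exists H.
- apply/closure_id/seteqP; split=> [|K clK]; first exact: subset_closure.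
  apply: subgroup_eq => g.
  have [_ -> /(_ g)] := (closure_subgroupP _ _).1 clK [:: g].
  by rewrite mem_head => /(_ isT) <-.
- by rewrite /= fixH.
- by apply: subset_closure; exists 1 => //; rewrite fixH.
Qed.

Lemma conj_trivial g : conj_sub g (trivial_subgroup G) = trivial_subgroup G.
Proof.
apply: subgroup_eq => h; rewrite conj_subE; split=> /= [|->].
  move=> /(congr1 (fun k => g * k / g)).
  by rewrite mulg1 mulgV !mulgA mulgV mul1g mulgK.
by rewrite mulg1 mulVg.
Qed.

Lemma conj_full g : conj_sub g (full_subgroup G) = full_subgroup G.
Proof. by apply: subgroup_eq => h; rewrite conj_subE. Qed.

Lemma URS_confined A : is_URS A -> A <> [set trivial_subgroup G] ->
  exists P : seq G, (forall p, p \in P -> p <> 1) /\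
    forall K, A K -> exists2 p, p \in P & sub_set K p.
Proof.
move=> uA nA; have [_ clA _ _] := uA.
have nA1 : (~` A) (trivial_subgroup G).
  by move=> A1; apply: nA; apply: URS_eq uA (URS_set1 conj_trivial) A1 _.
have /nbhs_subgroupP[s sA] := open_nbhs_nbhs (conj (closed_openC clA) nA1).
exists [seq p <- s | p != 1]; split=> [p|K AK].
  by rewrite mem_filter => /andP[/eqP].
apply: contrapT => noP; apply: sA AK => p ps /=.
split=> [Kp|->]; last exact: subgroup1.
by apply: contrapT => /eqP p1; apply: noP; exists p; rewrite // mem_filter p1.
Qed.

End URS.

(** * Rigid stabilizers *)

Section Action.
Variables (G : groupType) (X : topologicalType) (a : homeo_group G X).
Implicit Types (g h k : G) (x y : X) (U V W : set X).

Local Notation rist := (rigid_stabilizer a).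

Lemma actVK g : cancel (a g) (a g^-1).
Proof. by move=> x; rewrite -homeo_actM mulVg homeo_act1. Qed.

Lemma actKV g : cancel (a g^-1) (a g).
Proof. by move=> x; rewrite -homeo_actM mulgV homeo_act1. Qed.

Lemma act_faithful g h : (forall x, a g x = a h x) -> g = h.
Proof.
move=> gh; apply: divg1_eq; apply: (@homeo_act_faithful _ _ a) => x.
by rewrite homeo_actM gh actKV.
Qed.

Lemma act_moves g : g <> 1 -> exists x, a g x <> x.
Proof.
move=> g1; apply: contrapT => /forallNP fix_g; apply: g1.
by apply: (@homeo_act_faithful _ _ a) => x; apply: contrapT (fix_g x).
Qed.

Definition translate g U : set X := a g^-1 @^-1` U.

Lemma open_translate g U : open U -> open (translate g U).
Proof.
by move=> oU; apply: open_comp => // x _; apply: homeo_act_continuous.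
Qed.

Lemma in_translate g U x : translate g U x = U (a g^-1 x).
Proof. by []. Qed.

Lemma translate_act g U x : translate g U (a g x) = U x.
Proof. by rewrite /translate /= actVK. Qed.

Lemma rist1 U : rist U 1. Proof. by move=> x _; apply: homeo_act1. Qed.

Lemma ristM U g h : rist U g -> rist U h -> rist U (g * h).
Proof. by move=> Ug Uh x nUx; rewrite homeo_actM Uh // Ug. Qed.

Lemma ristV U g : rist U g -> rist U g^-1.
Proof. by move=> Ug x nUx; rewrite -[in LHS](Ug x nUx) actVK. Qed.

Lemma rist_subgroup U : is_subgroup (rist U).
Proof.
by apply/is_subgroupP; split=> [|g h Ug Uh]; [apply: rist1|apply/ristM/ristV].
Qed.

Lemma rist_mono U V : U `<=` V -> rist U `<=` rist V.
Proof. by move=> UV g Ug x nVx; apply: Ug => /UV. Qed.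

Lemma rist_conj U g k : rist U g -> rist (translate k U) (k * g * k^-1).
Proof. by move=> Ug x nUx; rewrite !homeo_actM Ug // actKV. Qed.

Lemma rist_stable U g x : rist U g -> U x -> U (a g x).
Proof.
move=> Ug Ux; apply: contrapT => nUgx; apply: (nUgx).
by have := ristV Ug nUgx; rewrite actVK => <-.
Qed.

Lemma rist_commute U V g h : U `&` V = set0 -> rist U g -> rist V h ->
  g * h = h * g.
Proof.
move=> UV0 Ug Vh; apply: act_faithful => x; rewrite !homeo_actM.
have UV y : U y -> ~ V y by move=> Uy Vy; have : (U `&` V) y by []; rewrite UV0.
have [Ux|nUx] := pselect (U x).
  by rewrite (Vh x (UV _ Ux)) (Vh _ (UV _ (rist_stable Ug Ux))).
rewrite (Ug x nUx); have [Vx|nVx] := pselect (V x).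
  by apply: Ug => /UV; apply; apply: rist_stable.
by rewrite (Vh x nVx) Ug.
Qed.

Lemma rist_disjoint U V g : U `&` V = set0 -> rist U g -> rist V g -> g = 1.
Proof.
move=> UV0 Ug Vg; apply: act_faithful => x; rewrite homeo_act1.
have [Ux|/Ug //] := pselect (U x); apply: Vg => Vx.
by have : (U `&` V) x by []; rewrite UV0.
Qed.

Lemma act_sep g x : hausdorff_space X -> a g x <> x ->
  exists V, [/\ open V, V x & translate g V `&` V = set0].
Proof.
rewrite open_hausdorff => T2 /eqP /T2[[A B] /= [/set_mem Agx /set_mem Bx]].
case=> oA oB /eqP AB0; exists (B `&` translate g^-1 A); split.
- by apply: openI => //; apply: open_translate.
- by split=> //; rewrite /translate /= invgK.
rewrite -subset0 => y [[_]]; rewrite /translate /= -homeo_actM invgK.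
by rewrite mulgV homeo_act1 => Ay [By _]; have : (A `&` B) y by []; rewrite AB0.
Qed.

Lemma rist_displaces U g : hausdorff_space X -> open U -> rist U g -> g <> 1 ->
  exists V, [/\ open V, V !=set0, V `<=` U & translate g V `&` V = set0].
Proof.
move=> T2 oU Ug /act_moves[x gx]; have [V [oV Vx gV]] := act_sep T2 gx.
exists (V `&` U); split; first exact: openI.
- by exists x; split=> //; apply: contrapT => /Ug.
- by move=> y [].
by rewrite -subset0 -gV => y [[? _] []].
Qed.

End Action.

(** * Confined subgroups contain local derived subgroups *)

Section Displacement.
Variables (G : groupType) (X : topologicalType) (a : homeo_group G X).
Hypothesis T2 : hausdorff_space X.
Implicit Types (g h k : G) (x y : X) (U V W : set X).

Local Notation rist := (rigid_stabilizer a).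
Local Notation translate := (translate a).

Definition contains_local_derived (H : subgroup G) : Prop :=
  exists V (Gamma : subgroup G), [/\ open V, V !=set0, Gamma `<=` rist V,
    finite_index Gamma (rist V) & derived Gamma `<=` H].

(** When p displaces U, the groups of elements supported in U and in its
    translate by p commute; this is the projection to the first factor of the
    part of H contained in their product. *)
Definition rist_projection p U (H : subgroup G) : set G :=
  [set g | rist U g /\ exists2 c, rist (translate p U) c & sub_set H (g * c)].

Section Projection.
Variables (p : G) (U : set X) (H : subgroup G).
Hypotheses (oU : open U) (pU : translate p U `&` U = set0).

Let com g c : rist U g -> rist (translate p U) c -> g * c = c * g.
Proof. by apply: rist_commute; rewrite setIC. Qed.

Lemma projection_subgroup : is_subgroup (rist_projection p U H).
Proof.
apply/is_subgroupP; split.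
  split; first exact: rist1.
  by exists 1; [exact: rist1|rewrite mulg1; exact: subgroup1].
move=> g h [Ug [c Uc Hgc]] [Uh [d Ud Hhd]]; split; first exact/ristM/ristV.
exists (c / d); first exact/ristM/ristV.
have := subgroupF Hgc Hhd; congr (sub_set H _).
rewrite invgM -!mulgA; congr (g * _).
have -> : d^-1 * h^-1 = h^-1 * d^-1 by rewrite -!invgM (com Uh Ud).
by rewrite !mulgA (com (ristV Uh) Uc).
Qed.

Lemma linked_projection k l : rist U k -> rist U l ->
  linked p H k l -> rist_projection p U H (k^-1 * l).
Proof.
move=> Uk Ul Hkl; split; first exact/ristM/Ul/ristV.
by exists (p * (k / l) * p^-1) => //; apply/rist_conj/ristM/ristV.
Qed.

(** An element of the projection conjugates m like the element of H above it,
    as the component supported in the translate of U commutes with m. *)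
Lemma projection_norm g m : rist_projection p U H g -> rist U m ->
  sub_set H m -> sub_set H (g^-1 * m * g).
Proof.
move=> [Ug [c Uc Hgc]] Um Hm.
have := subgroupM (subgroupM (subgroupV Hgc) Hm) Hgc; congr (sub_set H _).
rewrite invgM -!mulgA (com Ug Uc) (mulgA m) (com Um Uc) -!mulgA.
by rewrite (mulgA g^-1 c) (com (ristV Ug) Uc) !mulgA mulVg mul1g.
Qed.

(** Linked elements lie in the same left coset of the projection, so
    representatives of distinct cosets will do. *)
Lemma infinite_index_cliques (T : finType) :
  ~ finite_index (rist_projection p U H) (rist U) ->
  exists2 s : T -> G, forall t, rist U (s t) &
    forall t t', linked p H (s t) (s t') -> t = t'.
Proof.
move=> /infinite_index_reps[s sU sinj].
exists (fun t => s (enum_rank t)) => // t t' /linked_projection Dtt'.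
apply/enum_rank_inj/val_inj/sinj.
by apply: (coset_eq (H := Subgroup projection_subgroup)); apply: Dtt'.
Qed.

(** Double commutator trick. On an open set V displaced by m^-1, the commutator
    of m with an element g supported in V acts there as g, its other half being
    supported in a disjoint translate; so the commutator of [~ m, g] with h is
    [~ g, h]. *)
Lemma nontrivial_inter_contains_local_derived m :
  finite_index (rist_projection p U H) (rist U) ->
  rist U m -> sub_set H m -> m <> 1 -> contains_local_derived H.
Proof.
move=> fiD Um Hm m1.
have mV1 : m^-1 <> 1 by move=> e; apply/m1/invg_inj; rewrite e invg1.
have [V [oV V0 VU mV]] := rist_displaces T2 oU (ristV Um) mV1.
have [D1 DF] := (is_subgroupP _).1 projection_subgroup.
have [V1 VF] := (is_subgroupP _).1 (rist_subgroup a V).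
have subD : is_subgroup (rist_projection p U H `&` rist V).
  apply/is_subgroupP; split=> // g h [? ?] [? ?].
  by split; [apply: DF|apply: VF].
exists V, (Subgroup subD); split=> //.
- by move=> g [].
- by apply: (finite_index_inter (rist_subgroup a V) fiD); apply: rist_mono.
apply: derived_sub => g h [Dg Vg] [Dh Vh].
have Ug : rist U g by case: Dg.
have Hz : sub_set H (m^-1 * (g^-1 * m * g)).
  by apply: subgroupM; [apply: subgroupV|apply: projection_norm].
set z := _ * _ in Hz.
have Uz : rist U z.
  apply: ristM; first exact: ristV.
  by apply: ristM => //; apply: ristM => //; apply: ristV.
have := subgroupM (subgroupV Hz) (projection_norm Dh Uz Hz).
congr (sub_set H _).
have [w zE Vw] : exists2 w, z = w * g & rist (translate m^-1 V) w.
  exists (m^-1 * g^-1 * m); first by rewrite /z !mulgA.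
  by rewrite -[X in _ * _ * X]invgK; apply/rist_conj/ristV.
have wg : w * g = g * w by apply: rist_commute mV Vw Vg.
have wh : w * h = h * w by apply: rist_commute mV Vw Vh.
have Vgh : rist V [~ g, h].
  rewrite commgEl conjgE; apply: ristM; first exact: ristV.
  by apply: ristM; [apply: ristV|apply: ristM].
have wgh : w * [~ g, h] = [~ g, h] * w by apply: rist_commute mV Vw Vgh.
rewrite zE wg invgM -!mulgA wh -[RHS](mulKg w) wgh commgEl conjgE.
by rewrite -!mulgA.
Qed.

End Projection.

Section Rich.
Hypothesis rich : forall U, open U -> U !=set0 -> exists2 g, rist U g & g <> 1.

(** Take a non-trivial g supported in U and an open W inside U disjoint from
    its translate by g, then repeat inside W: the later elements preserve W, so
    g separates the final set from all its other translates. *)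
Lemma separating_family n U : open U -> U !=set0 ->
  exists V (x : nat -> G), [/\ open V, V !=set0, V `<=` U,
    forall i, (i < n)%N -> rist U (x i) &
    forall i j, (i < n)%N -> (j < n)%N -> i != j ->
      translate (x i) V `&` translate (x j) V = set0].
Proof.
elim: n U => [|n IHn] U oU U0; first by exists U, (fun=> 1); split.
have [g Ug g1] := rich oU U0.
have [W [oW W0 WU gW]] := rist_displaces T2 oU Ug g1.
have [V [x [oV V0 VW Wx sep]]] := IHn W oW W0.
exists V, (fun i => if i is i'.+1 then x i' else g); split=> //.
- exact: subset_trans WU.
- by case=> [_|i /Wx]; [|apply: rist_mono].
have sep0 i : (i < n)%N -> translate g V `&` translate (x i) V = set0.
  move=> lt_in; rewrite -subset0 -gW => z [gVz xVz]; split; first exact: VW.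
  rewrite -[z](actKV a (x i)); apply: rist_stable; first exact: Wx.
  exact: VW.
case=> [|i] [|j] //= lt_in lt_jn ij; [exact: sep0|rewrite setIC; exact: sep0|].
exact: sep.
Qed.

Lemma separating_inj n V (x : nat -> G) : V !=set0 ->
  (forall i j, (i < n)%N -> (j < n)%N -> i != j ->
      translate (x i) V `&` translate (x j) V = set0) ->
  forall i j, (i < n)%N -> (j < n)%N -> x i = x j -> i = j.
Proof.
move=> [y Vy] sep i j lt_in lt_jn xij; apply/eqP; case: eqVneq => // ij.
have : (translate (x i) V `&` translate (x j) V) (a (x i) y).
  by split; [|rewrite -xij]; rewrite translate_act.
by rewrite sep.
Qed.

(** With x_i separating V and y_j distinct elements supported in V, four linked
    corners of a rectangle give two elements of H with the same component in
    the translate of U. Their quotient is in the trivial group H `&` rist U,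
    which means that g = x_i^-1 * x_i' commutes with y_j / y_j'. As g displaces
    the support of the latter, j = j'. *)
Lemma trivial_inter_cliques n m p U (H : subgroup G) :
  open U -> U !=set0 -> (forall g, rist U g -> sub_set H g -> g = 1) ->
  exists2 s : 'I_n * 'I_m -> G, forall t, rist U (s t) &
    forall C : {set 'I_n * 'I_m},
      (forall t t', t \in C -> t' \in C -> linked p H (s t) (s t')) ->
      (#|C| <= m + n * n)%N.
Proof.
move=> oU U0 HU1.
have [V [x [oV V0 VU Ux xsep]]] := separating_family n oU U0.
have [W [y [oW W0 WV Vy ysep]]] := separating_family m oV V0.
have Uy j : (j < m)%N -> rist U (y j) by move=> /Vy; apply: rist_mono.
exists (fun t : 'I_n * 'I_m => x t.1 * y t.2) => [t|C cliqueC].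
  by apply: ristM; [apply: Ux|apply: Uy].
apply: card_rectangle_free => i i' j j' [Cij Ci'j Cij' Ci'j'].
have [->|ii'] := eqVneq i i'; [by left|right].
apply/val_inj/(separating_inj W0 ysep (ltn_ord j) (ltn_ord j'))/divg1_eq.
set g := (x i)^-1 * x i'.
have gw : g * (y j / y j') * g^-1 = y j / y j'.
  have zE : (x i * y j)^-1 * (x i' * y j) / ((x i * y j')^-1 * (x i' * y j')) =
      (y j)^-1 * (g * (y j / y j') * g^-1 * y j').
    by rewrite /g !invgM !invgK !mulgA.
  have := subgroupF (cliqueC _ _ Cij Ci'j) (cliqueC _ _ Cij' Ci'j').
  rewrite /= !mulgKA zE => /HU1 z1.
  have Ug : rist U g by apply: ristM; [apply/ristV/Ux|apply: Ux].
  have [Uyj Uyj'] := (Uy j (ltn_ord j), Uy j' (ltn_ord j')).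
  have/z1/(congr1 (fun h => y j * h / y j')) :
      rist U ((y j)^-1 * (g * (y j / y j') * g^-1 * y j')).
    apply: ristM; [exact: ristV|apply: ristM => //].
    by apply/ristM/ristV/Ug/ristM => //; apply/ristM/ristV.
  by rewrite mulVKg mulgK mulg1.
have Vjj' : rist V (y j / y j') by apply/ristM/ristV; apply: Vy.
have gV : V `&` translate g V = set0.
  rewrite -subset0 => v [Vv gVv].
  have : (translate (x i) V `&` translate (x i') V) (a (x i) v).
    split; first by rewrite translate_act.
    by rewrite in_translate -homeo_actM -[x i]invgK -invgM.
  by rewrite xsep.
have gwV : rist (translate g V) (y j / y j').
  by rewrite -gw; apply: rist_conj.
exact: rist_disjoint gV Vjj' gwV.
Qed.

(** There are no isolated points: the rigid stabilizer of an open singleton is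
    trivial. *)
Lemma avoid_points (s : seq X) U : open U -> U !=set0 ->
  exists2 x, U x & x \notin s.
Proof.
move=> oU U0; suff [V [_ [x Vx] VU Vs]] : exists V,
    [/\ open V, V !=set0, V `<=` U & forall x, V x -> x \notin s].
  by exists x; [apply: VU|apply: Vs].
elim: s => [|y s [V [oV [x Vx] VU Vs]]]; first by exists U; split.
have oVy : open (V `&` ~` [set y]).
  apply: openI => //; apply: closed_openC.
  exact/accessible_closed_set1/hausdorff_accessible.
have [V'0|V'0] := pselect (V `&` ~` [set y] !=set0).
  exists (V `&` ~` [set y]); split=> // [z [/VU]//|z [Vz /= /eqP zy]].
  by rewrite inE negb_or zy Vs.
have [g Vg []] := rich oV (ex_intro _ _ Vx).
have V1 z : V z -> z = y.
  by move=> Vz; apply: contrapT => zy; apply: V'0; exists z.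
apply: (act_faithful (a := a)) => z; rewrite homeo_act1.
have [Vz|/Vg//] := pselect (V z).
by rewrite (V1 _ (rist_stable Vg Vz)) -(V1 _ Vz).
Qed.

(** Each new point is chosen among the points moved by p n, away from finitely
    many points determined by the former ones. *)
Lemma separated_points n (p : nat -> G) (x0 : X) :
  (forall i, (i < n)%N -> p i <> 1) ->
  exists x : nat -> X, forall i j, (i < n)%N -> (j < n)%N ->
    (i != j -> x i <> x j) /\ a (p i) (x i) <> x j.
Proof.
elim: n => [|n IHn] p1; first by exists (fun=> x0).
have [x sep] := IHn (fun i lt_in => p1 i (ltnW lt_in)).
have [y py] := act_moves a (p1 n (ltnSn n)).
have [V [oV Vy pV]] := act_sep T2 py.
pose s := [seq x i | i <- iota 0 n] ++ [seq a (p i) (x i) | i <- iota 0 n] ++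
  [seq a (p n)^-1 (x i) | i <- iota 0 n].
have [z Vz] := avoid_points s oV (ex_intro _ _ Vy).
rewrite !mem_cat !negb_or => /and3P[zx zpx zqx].
have new (f : nat -> X) i : (i < n)%N ->
    z \notin [seq f i | i <- iota 0 n] -> z <> f i.
  by move=> lt_in + zf; rewrite zf map_f // mem_iota.
exists (fun i => if i == n then z else x i) => i j.
rewrite !ltnS (leq_eqVlt i) (leq_eqVlt j).
case: (eqVneq i n) => [->|ni] /= lt_in.
  case: (eqVneq j n) => [->|nj] /= lt_jn.
    split=> [//|pz].
    have : (translate (p n) V `&` V) z by split=> //; rewrite -pz translate_act.
    by rewrite pV.
  split=> [_|pz]; first exact: new.
  by apply: (new (fun i => a (p n)^-1 (x i)) j lt_jn zqx); rewrite -pz actVK.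
case: (eqVneq j n) => [->|nj] /= lt_jn; last exact: sep.
by split=> [_|] /esym; apply: new zx || apply: (new (fun i => a (p i) (x i))).
Qed.

Lemma finite_separation (s : seq X) : exists O : X -> set X,
  (forall x, open (O x) /\ O x x) /\
  forall x y, x \in s -> y \in s -> x != y -> O x `&` O y = set0.
Proof.
have /choice[A A_] : forall xy : X * X, exists AB : set X * set X,
    xy.1 != xy.2 ->
    [/\ open AB.1, open AB.2, AB.1 xy.1, AB.2 xy.2 & AB.1 `&` AB.2 = set0].
  move=> [x y] /=; have [->|xy] := eqVneq x y; first by exists (setT, setT).
  move: T2; rewrite open_hausdorff => /(_ _ _ xy)[[A B] /=].
  by move=> [/set_mem Ax /set_mem By] [oA oB /eqP AB]; exists (A, B).
pose B y x := if x == y then setT else (A (x, y)).1 `&` (A (y, x)).2.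
have B_ y x : open (B y x) /\ B y x x.
  rewrite /B; case: eqVneq => [_|xy]; first by split=> //; exact: openT.
  have [/= ? _ ? _ _] := A_ (x, y) xy.
  have [/= _ ? _ ? _] : [/\ _, _, _, _ & _] := A_ (y, x) (contra_neq esym xy).
  by split=> //; apply: openI.
exists (fun x => \big[setI/setT]_(y <- s) B y x); split=> [x|x y xs ys xy].
  split; last by elim/big_ind: _ => // y _; case: (B_ y x).
  elim/big_ind: _ => [|U V oU oV|y _]; [exact: openT|exact: openI|].
  by case: (B_ y x).
have sub u v : v \in s -> \big[setI/setT]_(y <- s) B y u `<=` B v u.
  elim: s {xs ys} => // w s IHs; rewrite inE big_cons.
  by move=> /predU1P[<-|/IHs IH] z [? ?] //; apply: IH.
rewrite -subset0 => z [/(sub _ _ ys) + /(sub _ _ xs)].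
rewrite /B (negPf xy) eq_sym (negPf xy) => -[Axy _] [_ Axy'].
by have [_ _ _ _ <-] := A_ (x, y) xy.
Qed.

Lemma disjoint_opens n (p : nat -> G) (x0 : X) :
  (forall i, (i < n)%N -> p i <> 1) ->
  exists U : nat -> set X,
    (forall i, (i < n)%N -> open (U i) /\ U i !=set0) /\
    forall i j, (i < n)%N -> (j < n)%N ->
      (i != j -> U i `&` U j = set0) /\ translate (p i) (U i) `&` U j = set0.
Proof.
move=> p1; have [x sep] := separated_points x0 p1.
pose S := [seq x i | i <- iota 0 n] ++ [seq a (p i) (x i) | i <- iota 0 n].
have Sx i : (i < n)%N -> x i \in S.
  by move=> lt_in; rewrite mem_cat map_f // mem_iota.
have Spx i : (i < n)%N -> a (p i) (x i) \in S.
  move=> lt_in; rewrite mem_cat (map_f (fun i => a (p i) (x i))) ?orbT //.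
  by rewrite mem_iota.
have [O [oO sepO]] := finite_separation S.
exists (fun i => O (x i) `&` translate (p i)^-1 (O (a (p i) (x i)))).
have sepOi i j u v : (i < n)%N -> (j < n)%N ->
    u \in [:: x i; a (p i) (x i)] -> v \in [:: x j; a (p j) (x j)] -> u <> v ->
    O u `&` O v = set0.
  move=> lt_in lt_jn ui vj /eqP uv.
  by apply: sepO => //; [move: ui|move: vj]; rewrite !inE => /orP[]/eqP->;
    [apply: Sx|apply: Spx|apply: Sx|apply: Spx].
split=> [i lt_in|i j lt_in lt_jn].
  have [[oO1 Ox1] [oO2 Ox2]] := (oO (x i), oO (a (p i) (x i))).
  split; first exact/openI/open_translate.
  by exists (x i); split=> //; rewrite in_translate invgK.
have [xij pxij] := sep i j lt_in lt_jn; split=> [/xij {}xij|].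
  rewrite -subset0 -(sepOi i j (x i) (x j)) ?inE ?eqxx // => y.
  by move=> [[? _] [? _]].
rewrite -subset0 -(sepOi i j (a (p i) (x i)) (x j)) ?inE ?eqxx ?orbT // => y.
by move=> [[_ +] [? _]]; rewrite in_translate invgK actKV.
Qed.

(** Colour an element of the product of the rigid stabilizers of the U i by an
    index of an element of P that the corresponding conjugate of H contains. If
    H contains no local derived subgroup, every factor has a grid all of whose
    linked subsets are too small for such a colouring to exist. *)
Theorem confined_contains_local_derived (P : seq G) (H : subgroup G) :
  (forall p, p \in P -> p <> 1) ->
  (forall g, exists2 p, p \in P & sub_set H (g^-1 * p * g)) ->
  contains_local_derived H.
Proof.
move=> P1 confined; apply: contrapT => noVD.
pose n := size P; pose p i := nth 1 P i.
have p1 i : (i < n)%N -> p i <> 1 by move=> lt_in; apply/P1/mem_nth.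
have [x0 _] : exists x0 : X, True.
  have [q /P1/(act_moves a)[x _] _] := confined 1; by exists x.
have [U [oU dU]] := disjoint_opens x0 p1.
(* A grid with n.+1 rows and m columns has linked subsets of size at most m +
   n.+1 * n.+1, and m is least such that n times this is less than n.+1 * m. *)
pose m := (n * (n.+1 * n.+1)).+1.
pose T : finType := ('I_n.+1 * 'I_m)%type.
have /choice[s s_] : forall i : 'I_n, exists s : T -> G,
    (forall t, rist (U i) (s t)) /\
    forall C : {set T},
      (forall t t', t \in C -> t' \in C -> linked (p i) H (s t) (s t')) ->
      (#|C| <= m + n.+1 * n.+1)%N.
  move=> i; have [oUi Ui0] := oU i (ltn_ord i).
  have [_ pUi] := dU i i (ltn_ord i) (ltn_ord i).
  pose D := rist_projection (p i) (U i) H.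
  have [fi|nfi] := pselect (finite_index D (rist (U i))); last first.
    have [s Us sC] := infinite_index_cliques pUi T nfi.
    exists s; split=> // C cliqueC; rewrite (@leq_trans 1) //.
    by apply/card_le1_eqP => t t' Ct Ct'; apply: sC; exact: cliqueC.
  have HU1 g : rist (U i) g -> sub_set H g -> g = 1.
    move=> Ug Hg; apply: contrapT => g1; apply: noVD.
    exact: (nontrivial_inter_contains_local_derived oUi pUi fi Ug Hg g1).
  by have [s Us sC] := trivial_inter_cliques n.+1 m (p i) oUi Ui0 HU1; exists s.
pose K (f : {ffun 'I_n -> T}) := \prod_(i < n) s i (f i).
have /choice[c c_] : forall f,
    exists i : 'I_n, sub_set H ((K f)^-1 * p i * K f).
  move=> f; have [q qP Hq] := confined (K f).
  have lt_qn : (index q P < n)%N by rewrite index_mem.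
  by exists (Ordinal lt_qn); rewrite /p /= nth_index.
have [|i [f]] := @exists_large_fibre n T (m + n.+1 * n.+1) c.
  by rewrite card_prod !card_ord mulnDr [(n.+1 * m)%N]mulSn addnC ltn_add2r.
rewrite ltnNge => /negP; apply; have [Us sC] := s_ i.
apply: sC => t t'; rewrite !inE => /eqP ct /eqP ct'.
have com (j k : 'I_n) g h : rist (U j) g -> rist (U k) h -> k != j ->
    commute g h.
  move=> Ug Uh kj; apply: rist_commute Ug Uh.
  by apply: (dU j k _ _).1 => //; rewrite eq_sym.
have updE u : update f i u i = u by rewrite ffunE eqxx.
have [||j ji|j ji|j ji|] := @prod_update _ _ (index_enum 'I_n)
  (fun j => s j (update f i t j)) (fun j => s j (update f i t' j)) i.
- exact: index_enum_uniq.
- exact: mem_index_enum.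
- by rewrite !ffunE (negPf ji).
- exact: com ((s_ i).1 _) ((s_ j).1 _) ji.
- exact: com ((s_ i).1 _) ((s_ j).1 _) ji.
rewrite !updE => quoL quoR; apply: linked_conj quoL quoR _.
- by have := c_ (update f i t); rewrite ct.
- by have := c_ (update f i t'); rewrite ct'.
have rp : rist (translate (p i) (U i)) (p i * (s i t / s i t') * (p i)^-1).
  exact/rist_conj/ristM/ristV.
apply: commute_prod => j _; apply: rist_commute rp ((s_ j).1 _).
by have [_] := dU i j (ltn_ord i) (ltn_ord j).
Qed.

End Rich.

End Displacement.

(** * Continuity points of the stabilizer map *)

Section Dynamics.
Variables (G : groupType) (X : topologicalType) (a : homeo_group G X).
Implicit Types (g h k : G) (x y : X) (U V W : set X) (A B : set (subgroup G)).

Local Notation rist := (rigid_stabilizer a).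

Lemma open_moved g : hausdorff_space X -> open [set x | a g x <> x].
Proof.
move=> T2; rewrite openE => x /(act_sep T2)[V [oV Vx gV]].
apply: filterS (open_nbhs_nbhs (conj oV Vx)) => y Vy gy.
have : (translate a g V `&` V) y by split=> //; rewrite -gy translate_act.
by rewrite gV.
Qed.

Lemma continuity_point_agree x (s : seq G) : stabilizer_continuity_points a x ->
  exists U, [/\ open U, U x &
    forall y g, U y -> g \in s -> a g y = y <-> a g x = x].
Proof.
move=> /(_ _ (agree_nbhs (stabilizer a x) s)) /=.
rewrite nbhsE => -[U [oU Ux] Us]; exists U; split=> // y g /Us.
by apply.
Qed.

Lemma continuity_pointP x : hausdorff_space X ->
  stabilizer_continuity_points a x <->
  forall g, a g x = x -> exists U, [/\ open U, U x & rist (~` U) g].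
Proof.
move=> T2; split=> [cx g gx|loc].
  have [U [oU Ux Ug]] := continuity_point_agree [:: g] cx.
  exists U; split=> // y /contrapT Uy.
  by apply/(Ug _ _ Uy); rewrite ?mem_head.
move=> B /nbhs_subgroupP[s sB].
suff : nbhs x [set y | agree_on s (stabilizer a x) (stabilizer a y)].
  by apply: filterS => y; apply: sB.
elim: s {sB} => [|g s IHs]; first by apply: filterS filterT => y _ g.
have gx : nbhs x [set y | a g y = y <-> a g x = x].
  have [fix_g|mov_g] := pselect (a g x = x).
    have [U [oU Ux Ug]] := loc g fix_g.
    apply: filterS (open_nbhs_nbhs (conj oU Ux)) => y Uy.
    by split=> // _; apply: Ug.
  by apply: filterS (open_nbhs_nbhs (conj (@open_moved g T2) mov_g)) => y.
apply: filterS (filterI gx IHs) => y [gy sy] h.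
by rewrite inE => /predU1P[->|/sy].
Qed.

Lemma shrink_open U : compact [set: X] -> hausdorff_space X ->
  open U -> U !=set0 -> exists V, [/\ open V, V !=set0 & closure V `<=` U].
Proof.
move=> Xc T2 oU [x Ux].
have [B Bx BU] := compact_regular T2 Xc filterT (open_nbhs_nbhs (conj oU Ux)).
move: Bx; rewrite nbhsE => -[V [oV Vx] VB].
by exists V; split=> //; [exists x|apply: subset_trans BU; apply: closureS].
Qed.

(** A Baire argument: nested open sets W n, with closure (W n.+1) inside W n,
    such that the n-th element of the group either fixes W n.+1 pointwise or
    has no fixed point in it. *)
Lemma exists_continuity_point : compact [set: X] -> hausdorff_space X ->
  countable [set: G] -> X -> exists x, stabilizer_continuity_points a x.
Proof.
move=> Xc T2 /countable_injP[e e_inj] x0.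
have /choice[F F_] : forall p : set X * nat, exists V, open p.1 -> p.1 !=set0 ->
    [/\ open V, V !=set0, closure V `<=` p.1 &
      forall g x, e g = p.2 -> V x -> a g x = x -> V `<=` [set y | a g y = y]].
  move=> [U n] /=; have [oU|noU] := pselect (open U); last by exists U.
  have [U0|nU0] := pselect (U !=set0); last by exists U.
  have [[g gn [z [Uz gz]]]|fixU] :=
    pselect (exists2 g, e g = n & exists z, U z /\ a g z <> z).
    have oU' : open (U `&` [set x | a g x <> x]) by exact/openI/open_moved.
    have [V [oV V0 VU]] := shrink_open Xc T2 oU' (ex_intro _ z (conj Uz gz)).
    exists V => _ _; split=> // [y /VU[]//|h x hn Vx hx].
    have gh : h = g by apply: e_inj; rewrite ?in_setT // gn.
    by have /VU[_] := subset_closure Vx; rewrite -gh.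
  have [V [oV V0 VU]] := shrink_open Xc T2 oU U0.
  exists V => _ _; split=> // g x gn _ _ y Vy; apply: contrapT => gy.
  by apply: fixU; exists g => //; exists y; split=> //; apply/VU/subset_closure.
pose W := fix W n := if n is m.+1 then F (W m, m) else [set: X].
have W_ n : open (W n) /\ W n !=set0.
  elim: n => [|n [oW W0]]; first by split; [exact: openT|exists x0].
  by have [] := F_ (W n, n) oW W0.
have WS n : closure (W n.+1) `<=` W n.
  by have [oW W0] := W_ n; have [] := F_ (W n, n) oW W0.
have Wle m n : (m <= n)%N -> W n `<=` W m.
  move=> /subnK <-; elim: (n - m)%N => // k IHk.
  rewrite addSn; apply: subset_trans IHk; apply: subset_trans (WS _).
  exact: subset_closure.
have FW : ProperFilter (filter_from setT W).
  apply: filter_from_proper; last by move=> n _; case: (W_ n).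
  apply: filter_from_filter; first by exists 0%N.
  move=> m n _ _; exists (maxn m n) => // y Wy.
  by split; move: Wy; apply: Wle; rewrite ?leq_maxl ?leq_maxr.
have [x [_ clx]] := Xc _ FW filterT.
have Wx n : W n x by apply: WS => B; apply: clx; exists n.+1.
exists x; apply/continuity_pointP => // g gx.
have [oW W0] := W_ (e g); have [oV _ _ Vg] := F_ (W (e g), e g) oW W0.
exists (W (e g).+1); split; [exact: oV|exact: Wx|].
by move=> y /contrapT Wy; apply: (Vg g x erefl (Wx (e g).+1) gx).
Qed.

Lemma conj_stabilizer g x : conj_sub g (stabilizer a x) = stabilizer a (a g x).
Proof.
apply: subgroup_eq => h; rewrite conj_subE; split=> /=.
  by rewrite !homeo_actM => /(congr1 (a g)); rewrite actKV.
by move=> hgx; rewrite !homeo_actM hgx actVK.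
Qed.

Lemma continuity_point_act g x : hausdorff_space X ->
  stabilizer_continuity_points a x -> stabilizer_continuity_points a (a g x).
Proof.
move=> T2 /(continuity_pointP _ T2) loc.
apply/(continuity_pointP _ T2) => h hgx.
have [|U [oU Ux Uh]] := loc (g^-1 * h * g).
  by rewrite !homeo_actM hgx actVK.
exists (translate a g U).
split; [exact: open_translate|by rewrite translate_act|].
move=> y /contrapT Uy; have /(_ (a g^-1 y)) := Uh.
rewrite !homeo_actM actKV => /(_ (fun nU => nU Uy)) /(congr1 (a g)).
by rewrite !actKV.
Qed.

(** Finitely many elements of the stabilizer of x fix a neighbourhood U of x
    pointwise; the complement of U is compressed to a point z and then moved
    into V by minimality. *)
Lemma dominate_stabilizer A (K : subgroup G) V x :
  extreme_boundary_action a -> closed A ->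
  (forall g H, A H -> A (conj_sub g H)) ->
  A K -> open V -> V !=set0 -> rist V `<=` K ->
  stabilizer_continuity_points a x ->
  exists2 L, A L & stabilizer a x `<=` (L : set G).
Proof.
move=> [Xc minX epX] clA invA AK oV [v Vv] VK cx; apply: limit_above clA _.
move=> s sx; have [U [oU Ux Us]] := continuity_point_agree s cx.
have [z zU] : compressible a (~` U).
  apply: epX; first exact: open_closedC.
  by move=> UT; have : [set: X] x by []; rewrite -UT.
have [_ [[h _ <-] Vhz]] := minX z I v I _ (open_nbhs_nbhs (conj oV Vv)).
have [|g gU] := zU (translate a h^-1 V) (@open_translate _ _ a h^-1 _ oV).
  by rewrite in_translate invgK.
exists (conj_sub (h * g)^-1 K); first exact: invA.
move=> f fs; rewrite conj_subE invgK; apply: VK.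
have fU : rist (~` U) f.
  by move=> y /contrapT Uy; apply/(Us _ _ Uy fs)/sx.
apply: rist_mono (rist_conj fU) => y.
rewrite in_translate invgM homeo_actM => Uy.
have := gU _ (ex_intro2 _ _ _ Uy erefl).
by rewrite actKV in_translate invgK actKV.
Qed.

End Dynamics.

(** * The stabilizer URS *)

Section StabilizerURS.
Variables (G : groupType) (X : topologicalType) (a : homeo_group G X).
Hypotheses (Xc : compact [set: X]) (T2 : hausdorff_space X).
Hypothesis minX : minimal_on a [set: X].

(** By minimality and compactness, the elements of a finite list r suffice to
    bring any point into the neighbourhood U of x. So for a stabilizer of a point,
    and then for its limit K, some conjugate by an element of r agrees on s
    with the stabilizer of x: the conjugates of s by r form a finite set. *)
Lemma stabilizer_in_orbit_closure K x : stabilizer_URS a K ->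
  stabilizer_continuity_points a x ->
  closure (act_orbit (@conj_sub G) K) (stabilizer a x).
Proof.
move=> SK cx; apply/closure_subgroupP => s.
have [U [oU Ux Us]] := continuity_point_agree s cx.
have [r rU] : exists r : seq G, forall y, exists2 g, g \in r & U (a g y).
  apply: contrapT => /forallNP nr.
  pose B (r : seq G) := [set y | forall g, g \in r -> ~ U (a g y)].
  have FB : ProperFilter (filter_from setT B).
    apply: filter_from_proper => [|r _].
      apply: filter_from_filter => [|r t _ _]; first by exists [::].
      exists (r ++ t) => // y rty.
      by split=> g gr; apply: rty; rewrite mem_cat gr ?orbT.
    have /existsNP[y ny] := nr r; exists y => g gr Ugy.
    by apply: ny; exists g.
  have [y [_ cly]] := Xc FB filterT.
  have [_ [[g _ <-] Ugy]] := minX (x := y) I I (open_nbhs_nbhs (conj oU Ux)).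
  have oUg : open_nbhs y (translate a g^-1 U).
    by split; [exact: open_translate|rewrite in_translate invgK].
  have Bg : filter_from setT B (B [:: g]) by exists [:: g].
  have [w [/(_ g (mem_head _ _))]] := cly _ _ Bg (open_nbhs_nbhs oUg).
  by rewrite in_translate invgK.
have [_ [y cy <-] yK] := (closure_subgroupP _ _).1 SK
  [seq g^-1 * f * g | g <- r, f <- s].
have [g gr Ugy] := rU y.
exists (conj_sub g K); first by exists g.
move=> f fs; have := yK (g^-1 * f * g) (allpairs_f _ gr fs).
rewrite conj_subE => <- /=; rewrite -(Us _ _ Ugy fs) !homeo_actM.
by split=> [/(congr1 (a g))|->]; rewrite ?actKV ?actVK.
Qed.

Lemma stabilizer_URS_is_URS : stabilizer_continuity_points a !=set0 ->
  is_URS (stabilizer_URS a).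
Proof.
move=> [x cx]; split.
- by exists (stabilizer a x); apply: subset_closure; exists x.
- exact: closed_closure.
- move=> g K SK; apply/closure_subgroupP => s.
  have [_ [y cy <-] yK] :=
    (closure_subgroupP _ _).1 SK [seq g^-1 * f * g | f <- s].
  exists (stabilizer a (a g y)).
    by exists (a g y) => //; apply: continuity_point_act.
  by move=> f fs; rewrite -conj_stabilizer !conj_subE; apply: yK; apply: map_f.
- move=> K SK; rewrite ((closure_id _).1 (@closed_closure _ (act_orbit _ K))).
  by apply: closureS => _ [y cy <-]; apply: stabilizer_in_orbit_closure.
Qed.

End StabilizerURS.

(** * Comparison with the stabilizer URS *)

Section NontrivialURS.
Variables (G : groupType) (X : topologicalType) (a : homeo_group G X).
Hypotheses (T2 : hausdorff_space X).
Hypothesis a_rigid : forall U : set X, open U -> U !=set0 ->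
  forall Gamma : subgroup G, Gamma `<=` rigid_stabilizer a U ->
    finite_index Gamma (rigid_stabilizer a U) ->
    exists V : set X, [/\ open V, V !=set0, V `<=` U
      & rigid_stabilizer a V `<=` derived Gamma].

Lemma confined_rigid_stabilizer (P : seq G) (H : subgroup G) :
  (forall p, p \in P -> p <> 1) ->
  (forall g, exists2 p, p \in P & sub_set H (g^-1 * p * g)) ->
  exists V, [/\ open V, V !=set0 & rigid_stabilizer a V `<=` H].
Proof.
move=> P1 confined.
have [[W [oW W0 W1]]|rich] := pselect (exists W, [/\ open W, W !=set0 &
    forall g, rigid_stabilizer a W g -> g = 1]).
  by exists W; split=> // g /W1->; apply: subgroup1.
have move_in U : open U -> U !=set0 ->
    exists2 g, rigid_stabilizer a U g & g <> 1.
  move=> oU U0; apply: contrapT => noU; apply: rich; exists U; split=> // g Ug.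
  by apply: contrapT => g1; apply: noU; exists g.
have [U [Gamma [oU U0 GU GfU GH]]] :=
  confined_contains_local_derived T2 move_in P1 confined.
have [V [oV V0 _ VG]] := a_rigid oU U0 GU GfU.
by exists V; split=> //; apply: subset_trans GH.
Qed.

End NontrivialURS.

Theorem corollary3p12 (G : groupType) (X : topologicalType)
  (a : homeo_group G X)
  (X_compact : compact [set: X]) (X_hausdorff : hausdorff_space X)
  (G_countable : countable [set: G])
  (a_extreme : extreme_boundary_action a)
  (a_rigid : forall U : set X, open U -> U !=set0 ->
     forall Gamma : subgroup G, Gamma `<=` rigid_stabilizer a U ->
       finite_index Gamma (rigid_stabilizer a U) ->
       exists V : set X, [/\ open V, V !=set0, V `<=` U
         & rigid_stabilizer a V `<=` derived Gamma]) :
  (forall H : set (subgroup G), is_URS H -> H <> [set trivial_subgroup G] ->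
     sub_preceq (stabilizer_URS a) H) /\
  ((exists2 H : subgroup G, stabilizer_URS a H & maximal_subgroup H) ->
   forall H : set (subgroup G), is_URS H <->
     [\/ H = [set trivial_subgroup G], H = stabilizer_URS a
       | H = [set full_subgroup G]]).
Proof.
have stab_preceq A : is_URS A -> A <> [set trivial_subgroup G] ->
    sub_preceq (stabilizer_URS a) A.
  move=> uA nA; have [P [P1 AP]] := URS_confined uA nA.
  have [[K AK] clA invA _] := uA.
  have [p pP _] := AP K AK; have [x0 _] := act_moves a (P1 p pP).
  have [|V [oV V0 VK]] :=
    confined_rigid_stabilizer X_hausdorff a_rigid P1 (H := K).
    move=> g; have [q qP] := AP _ (invA g _ AK).
    by rewrite conj_subE; exists q.
  have [x cx] := exists_continuity_point a X_compact X_hausdorff G_countable x0.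
  have [L AL xL] := dominate_stabilizer a_extreme clA invA AK oV V0 VK cx.
  exists (stabilizer a x), L; split=> //; apply: subset_closure.
  by exists x.
split=> // -[M SM [_ maxM]] A.
have uS : is_URS (stabilizer_URS a).
  apply: stabilizer_URS_is_URS => //; first by case: a_extreme.
  by have [_ [x cx _] _] := (closure_subgroupP _ _).1 SM [::]; exists x.
have [uT uF] := (URS_set1 (@conj_trivial G), URS_set1 (@conj_full G)).
split=> [uA|[]->//].
have [->|nA] := pselect (A = [set trivial_subgroup G]); first by constructor 1.
have [H [K [SH AK HK]]] := stab_preceq A uA nA.
have [_ clA invA _] := uA; have [_ _ _ minS] := uS.
have [s sM|L AL ML] := limit_above clA (M := M).
  have [_ [g _ <-] gH] := (closure_subgroupP _ _).1 (minS _ SH _ SM) s.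
  exists (conj_sub g K); first exact: invA.
  move=> h hs; have := (gH h hs).2 (sM h hs); rewrite !conj_subE; exact: HK.
have [LM|LF] := maxM L ML; rewrite ?LM ?LF in AL.
  by constructor 2; apply: URS_eq uA uS AL SM.
by constructor 3; apply: URS_eq uA uF AL _.
Qed.
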